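(* The only $B4$-collinear integers are $1$, $2$, and $5$. That is, a positive integer $k$ is $B4$-collinear if and only if $k\in\{1,2,5\}$.
   Context: A lattice triangle is a (non-degenerate) triangle in the plane whose three vertices lie in $\mathbb{Z}^2$. Its boundary points are the points of $\mathbb{Z}^2$ on its boundary (vertices included), and its interior points are the points of $\mathbb{Z}^2$ in its topological interior. For a positive integer $n$, a positive integer $k$ is called $Bn$-collinear if (i) there exists at least one lattice triangle with exactly $n$ boundary points and exactly $k$ interior points, and (ii) for every lattice triangle with exactly $n$ boundary points and exactly $k$ interior points, the $k$ interior points all lie on a common line. *)

(* Defs.v *)
From HB Require Import structures.
From mathcomp Require Import all_boot all_order all_algebra.
From mathcomp Require Import all_classical all_reals all_analysis.

Set Implicit Arguments.
Unset Strict Implicit.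
Unset Printing Implicit Defensive.

Import Order.TTheory GRing.Theory Num.Theory.
Import numFieldNormedType.Exports.

Local Open Scope classical_set_scope.
Local Open Scope card_scope.
Local Open Scope ring_scope.

(* The plane is the topological product R * R, and Z^2 is a subset of it. *)
Definition lattice (R : realType) : set (R * R) :=
  [set p | p.1 \is a Num.int /\ p.2 \is a Num.int].

Definition line (R : realType) (a b c : R) : set (R * R) :=
  [set p | a * p.1 + b * p.2 = c].

Definition collinear (R : realType) (S : set (R * R)) : Prop :=
  exists a b c : R, (a, b) <> (0, 0) /\ S `<=` line a b c.

Definition triangle (R : realType) (A B C : R * R) : set (R * R) :=
  [set p | exists a b c : R,
    [/\ 0 <= a, 0 <= b & 0 <= c] /\
    [/\ a + b + c = 1,
        p.1 = a * A.1 + b * B.1 + c * C.1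
      & p.2 = a * A.2 + b * B.2 + c * C.2]].

Definition lattice_triangle (R : realType) (A B C : R * R) : Prop :=
  [/\ lattice A, lattice B, lattice C & ~ collinear [set A; B; C]].

Definition frontier (T : topologicalType) (S : set T) : set T :=
  closure S `\` interior S.

Definition boundary_points (R : realType) (A B C : R * R) : set (R * R) :=
  @lattice R `&` frontier (triangle A B C).

Definition interior_points (R : realType) (A B C : R * R) : set (R * R) :=
  @lattice R `&` interior (triangle A B C).

Definition has_counts (R : realType) (n k : nat) (A B C : R * R) : Prop :=
  [/\ lattice_triangle A B C,
      boundary_points A B C #= `I_n
    & interior_points A B C #= `I_k].

(* The notion is meant for n, k > 0; for k = 0 the collinearity is vacuous. *)
Definition B_collinear (R : realType) (n k : nat) : Prop :=
  (exists A B C : R * R, has_counts n k A B C) /\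
  (forall A B C : R * R, has_counts n k A B C ->
    collinear (interior_points A B C)).

(* Main.v *)
Require Import Defs.
From mathcomp Require Import all_boot all_order all_algebra.
From mathcomp Require Import all_classical all_reals all_analysis.
From mathcomp Require Import zify ring lra.

Set Implicit Arguments.
Unset Strict Implicit.
Unset Printing Implicit Defensive.

Import Order.TTheory GRing.Theory Num.Theory.
Import numFieldNormedType.Exports.

Local Open Scope classical_set_scope.
Local Open Scope card_scope.
Local Open Scope ring_scope.

(* Among the edges of a lattice triangle with 4 boundary points one has lattice
   length 2 and the other two have lattice length 1, so an affine unimodular map
   brings the triangle to the vertices (0,0), (2,0), (p,h) with p and p - 2
   coprime to h.  The rows y and h - y together contain exactly 2 interior
   lattice points, hence k = h - 1.  If h is 2, 3 or 6 then p = 1 modulo h, and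
   after a shear all interior points have abscissa 1.  For every other h >= 4
   some admissible p satisfies 2 < p < h; then (1,1) and (2,1) are interior and
   are the only interior points of their row, while k >= 3. *)

(** * Orientation, and lattice points on the edges of an integer triangle *)

(** Twice the signed area of the triangle [A], [B], [P]. The ring is left general so that integer
    and real points share it. *)
Definition orient (V : comNzRingType) (A B P : V * V) : V :=
  (B.1 - A.1) * (P.2 - A.2) - (B.2 - A.2) * (P.1 - A.1).

Definition edge_gcd (A B : int * int) : nat := gcdn `|B.1 - A.1| `|B.2 - A.2|.

(** Dividing Bezout's identity by the gcd yields a direction [(w1, w2)] whose primitivity is an
    equation. *)
Lemma edge_gcdP (A B : int * int) : (0 < edge_gcd A B)%N ->
  exists w1 w2 s t : int, [/\ B.1 - A.1 = w1 * (edge_gcd A B)%:Z,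
    B.2 - A.2 = w2 * (edge_gcd A B)%:Z & s * w1 + t * w2 = 1].
Proof.
rewrite /edge_gcd => g0.
have [s [t e]] := Bezoutz (B.1 - A.1) (B.2 - A.2).
have /dvdzP[w1 e1] := dvdz_gcdl (B.1 - A.1) (B.2 - A.2).
have /dvdzP[w2 e2] := dvdz_gcdr (B.1 - A.1) (B.2 - A.2).
rewrite {}/gcdz in e e1 e2.
move: (gcdn _ _) g0 e e1 e2 => g g0 e e1 e2.
exists w1, w2, s, t; split=> //.
by rewrite e1 e2 in e; nia.
Qed.

(* Lattice points of the half-open edge [A, B[. *)
Definition segment (A B : int * int) : seq (int * int) :=
  [seq (A.1 + i%:Z * ((B.1 - A.1) %/ edge_gcd A B)%Z,
        A.2 + i%:Z * ((B.2 - A.2) %/ edge_gcd A B)%Z) | i <- iota 0 (edge_gcd A B)].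

Lemma size_segment A B : size (segment A B) = edge_gcd A B.
Proof. by rewrite size_map size_iota. Qed.

Lemma edge_gcd_gt0 A B C : 0 < orient A B C -> (0 < edge_gcd A B)%N.
Proof.
case: A B C => [a1 a2] [b1 b2] [c1 c2].
rewrite /orient /edge_gcd gcdn_gt0 /= => D.
rewrite !absz_gt0; apply/norP => -[/negPn/eqP e1 /negPn/eqP e2].
by rewrite e1 e2 !mul0r subrr ltxx in D.
Qed.

Lemma segment_uniq A B C : 0 < orient A B C -> uniq (segment A B).
Proof.
move=> D; have g0 := edge_gcd_gt0 D.
have [w1 [w2 [s [t [e1 e2 e]]]]] := edge_gcdP g0.
rewrite map_inj_uniq ?iota_uniq// => i j [].
rewrite e1 e2 !mulzK; [|lia|lia] => /addrI E1 /addrI E2.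
have : i%:Z * (s * w1 + t * w2) = j%:Z * (s * w1 + t * w2).
  by rewrite !mulrDr ![_ * (s * _)]mulrCA ![_ * (t * _)]mulrCA E1 E2.
by rewrite e !mulr1 => -[].
Qed.

(** Lattice points on the line through [A] and [B] are [A + k w] with [w] primitive and [k] an
    integer. The other two forms are [g - k] and [k] times a positive factor, so they say
    [0 <= k < g]; the strict one excludes the end [B]. *)
Lemma mem_segment A B C P : 0 < orient A B C ->
  (P \in segment A B) =
  [&& orient A B P == 0, 0 < orient B C P & 0 <= orient C A P].
Proof.
move=> D; have g0 := edge_gcd_gt0 D.
have [w1 [w2 [s [t [e1 e2 e]]]]] := edge_gcdP g0.
rewrite /segment e1 e2 !mulzK; last 2 first.
- by lia.
- by lia.
move: (edge_gcd A B) g0 e1 e2 => g g0 e1 e2.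
have E1 : B.1 = A.1 + w1 * g%:Z by rewrite -e1 addrC subrK.
have E2 : B.2 = A.2 + w2 * g%:Z by rewrite -e2 addrC subrK.
have D' : orient A B C = g%:Z * (w1 * (C.2 - A.2) - w2 * (C.1 - A.1)).
  by rewrite /orient E1 E2; ring.
have d0 : 0 < w1 * (C.2 - A.2) - w2 * (C.1 - A.1) by move: D; rewrite D' pmulr_rgt0.
apply/mapP/and3P => [[i] | [/eqP c0 c1 c2]].
  rewrite mem_iota /orient => /andP[_ i1] ->/=; rewrite E1 E2; split.
  - by apply/eqP; ring.
  - have -> : (C.1 - (A.1 + w1 * g)) * (A.2 + i%:Z * w2 - (A.2 + w2 * g)) -
      (C.2 - (A.2 + w2 * g)) * (A.1 + i%:Z * w1 - (A.1 + w1 * g))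
      = (g%:Z - i%:Z) * (w1 * (C.2 - A.2) - w2 * (C.1 - A.1)) by ring.
    by rewrite mulr_gt0//; lia.
  - have -> : (A.1 - C.1) * (A.2 + i%:Z * w2 - C.2) -
      (A.2 - C.2) * (A.1 + i%:Z * w1 - C.1)
      = i%:Z * (w1 * (C.2 - A.2) - w2 * (C.1 - A.1)) by ring.
    by rewrite mulr_ge0//; lia.
(* Since [s * w1 + t * w2 = 1], this combination recovers the coefficient of [P - A] along
   [(w1, w2)]. *)
pose k := s * (P.1 - A.1) + t * (P.2 - A.2).
have c0' : w1 * (P.2 - A.2) - w2 * (P.1 - A.1) = 0.
  have : g%:Z * (w1 * (P.2 - A.2) - w2 * (P.1 - A.1)) = 0.
    by rewrite -c0 /orient E1 E2; ring.
  by move/eqP; rewrite mulf_eq0 => /orP[|/eqP//]; lia.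
have k1 : P.1 = A.1 + k * w1.
  apply/eqP; rewrite -subr_eq0; apply/eqP.
  have -> : P.1 - (A.1 + k * w1) = (1 - (s * w1 + t * w2)) * (P.1 - A.1)
    - t * (w1 * (P.2 - A.2) - w2 * (P.1 - A.1)) by rewrite /k; ring.
  by rewrite c0' e; ring.
have k2 : P.2 = A.2 + k * w2.
  apply/eqP; rewrite -subr_eq0; apply/eqP.
  have -> : P.2 - (A.2 + k * w2) = (1 - (s * w1 + t * w2)) * (P.2 - A.2)
    + s * (w1 * (P.2 - A.2) - w2 * (P.1 - A.1)) by rewrite /k; ring.
  by rewrite c0' e; ring.
have k_ge0 : 0 <= k.
  move: c2; suff -> : orient C A P = k * (w1 * (C.2 - A.2) - w2 * (C.1 - A.1)).
    by rewrite pmulr_lge0.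
  by rewrite /orient k1 k2; ring.
have k_lt : k < g%:Z.
  move: c1; suff -> : orient B C P = (g%:Z - k) * (w1 * (C.2 - A.2) - w2 * (C.1 - A.1)).
    by rewrite pmulr_lgt0// subr_gt0.
  by rewrite /orient k1 k2 E1 E2; ring.
exists `|k|%N; first by rewrite mem_iota; lia.
by rewrite gez0_abs// -k1 -k2 -surjective_pairing.
Qed.

(** Half-open edges taken cyclically list each vertex only once. *)
Definition boundary_seq A B C := segment A B ++ segment B C ++ segment C A.

Lemma orient_rot (V : comNzRingType) (A B C : V * V) :
  orient B C A = orient A B C.
Proof. by rewrite /orient; ring. Qed.

Lemma orient_swap (V : comNzRingType) (A B C : V * V) : orient B A C = - orient A B C.
Proof. by rewrite /orient; ring. Qed.

Lemma orientD (V : comNzRingType) (A B C P : V * V) :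
  orient A B P + orient B C P + orient C A P = orient A B C.
Proof. by rewrite /orient; ring. Qed.

Lemma size_boundary_seq A B C : size (boundary_seq A B C) =
  (edge_gcd A B + edge_gcd B C + edge_gcd C A)%N.
Proof. by rewrite !size_cat !size_segment addnA. Qed.

(** The three forms add up to [orient A B C > 0], so they never vanish together, and a point with a
    zero form lies on some half-open edge. *)
Lemma mem_boundary_seq A B C P : 0 < orient A B C ->
  (P \in boundary_seq A B C) =
  [&& 0 <= orient A B P, 0 <= orient B C P, 0 <= orient C A P &
   ~~ [&& 0 < orient A B P, 0 < orient B C P & 0 < orient C A P]].
Proof.
move=> D; have D1 : 0 < orient B C A by rewrite orient_rot.
have D2 : 0 < orient C A B by rewrite orient_rot.
rewrite !mem_cat (mem_segment _ D) (mem_segment _ D1) (mem_segment _ D2).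
have := orientD A B C P; lia.
Qed.

Lemma boundary_seq_uniq A B C : 0 < orient A B C -> uniq (boundary_seq A B C).
Proof.
move=> D; have D1 : 0 < orient B C A by rewrite orient_rot.
have D2 : 0 < orient C A B by rewrite orient_rot.
rewrite !cat_uniq (segment_uniq D) (segment_uniq D1) (segment_uniq D2)/= andbT.
by apply/andP; split; apply/hasPn => P; rewrite ?mem_cat/=
  ?(mem_segment _ D) ?(mem_segment _ D1) ?(mem_segment _ D2); lia.
Qed.

(** * Interior lattice points of the normalized triangle, and their number *)

(* Interior lattice points of the triangle (0,0), (2,0), (p,h): the row y has
   width less than 2, so only the two integers following p y / h can occur. *)
Definition interior_seq (p : int) (h : nat) : seq (int * int) :=
  [seq z <- [seq (((p * y%:Z) %/ h)%Z + 1 + b%:Z, y%:Z) | y <- iota 1 h.-1, b <- iota 0 2]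
  | z.1 * h%:Z - z.2 * p + z.2 *+ 2 < h%:Z *+ 2].

Lemma mem_interior_seq p h z : (0 < h)%N ->
  (z \in interior_seq p h) =
  [&& 0 < z.2, 0 < z.1 * h%:Z - z.2 * p & z.1 * h%:Z - z.2 * p + z.2 *+ 2 < h%:Z *+ 2].
Proof.
move=> h0; rewrite mem_filter; case: z => x y; rewrite -[(x, y).1]/x -[(x, y).2]/y.
have d := divz_eq (p * y) h%:Z.
have m0 : 0 <= ((p * y) %% h%:Z)%Z by rewrite modz_ge0//; lia.
have m1 : ((p * y) %% h%:Z)%Z < h%:Z by rewrite ltz_pmod//; lia.
move: (_ %% _)%Z m0 m1 d => r m0 m1 d.
apply/andP/and3P => [[c /allpairsPdep[i [b []]]] | [y0 c0 c]].
  rewrite !mem_iota /= => i1 b1 [ex ey]; rewrite ey in d c *.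
  by split => //; first lia; rewrite ex (mulrC _ p) d; nia.
split=> //; set q := ((p * y) %/ h%:Z)%Z in d *.
(* With [p y = q h + r] the two edge conditions give [q < x < q + 3], so [x - q - 1] is 0 or 1. *)
rewrite (mulrC y) d in c c0.
have q1 : q < x.
  by rewrite -(@ltr_pM2r _ h%:Z) ?ltz_nat//; lia.
have q2 : x < q + 3.
  by rewrite -(@ltr_pM2r _ h%:Z) ?ltz_nat// mulrDl; lia.
apply/allpairsPdep; exists `|y|%N, (absz (x - q - 1)%R).
rewrite !mem_iota/= gez0_abs ?(ltW y0)// -/q.
by split; first [lia | congr pair; lia].
Qed.

Lemma interior_seq_uniq p h : uniq (interior_seq p h).
Proof.
apply: filter_uniq; apply: allpairs_uniq; rewrite ?iota_uniq//.
by move=> [y b] [y' b'] _ _ [/= + e]; rewrite e => ?; congr pair; lia.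
Qed.

(** The reflection [x -> p - x] carries row [h - y] to an interval ending at [p y / h], where row
    [y] starts. Together they span length 2, from [(p - 2) y / h]; by coprimality neither this end
    nor the junction is an integer, so they contain exactly 2 integers. Adding the sum over the rows
    to its reversal then gives [2 (h - 1)]. *)
Lemma size_interior_seq p h : (0 < h)%N -> coprimez p h -> coprimez (p - 2) h ->
  size (interior_seq p h) = h.-1.
Proof.
move=> h0 ph ph2.
pose c (y b : nat) : bool :=
  (((p * y%:Z) %/ h)%Z + 1 + b%:Z) * h%:Z - y%:Z * p + y%:Z *+ 2 < h%:Z *+ 2.
have -> : size (interior_seq p h) = (\sum_(1 <= y < h) (c y 0 + c y 1))%N.
  rewrite size_filter -sum1_count big_mkcond big_allpairs_dep.
  rewrite (_ : iota 1 _ = index_iota 1 h); last by rewrite /index_iota subn1.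
  by apply: eq_bigr => y _; rewrite big_cons big_seq1 /c; do 2!case: ifP.
have pair_count y : (0 < y < h)%N -> (c y 0 + c y 1 + (c (h - y) 0 + c (h - y) 1) = 2)%N.
  move=> /andP[y0 y1]; rewrite /c.
  have d := divz_eq (p * y) h%:Z.
  have m0 : 0 <= ((p * y%:Z) %% h%:Z)%Z by rewrite modz_ge0//; lia.
  have m1 : ((p * y%:Z) %% h%:Z)%Z < h%:Z by rewrite ltz_pmod//; lia.
  have ndvd (a : int) : coprimez a h -> ~~ (h%:Z %| a * y)%Z.
    by rewrite coprimez_sym => ah; rewrite Gauss_dvdzr// dvdzE/= gtnNdvd.
  (* No lattice point of this row lies on the left edge ([m2]) or on the right edge ([m3]). *)
  have m2 : ((p * y%:Z) %% h%:Z)%Z != 0 by apply: contra (ndvd _ ph) => /eqP/dvdz_mod0P.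
  have m3 (a : int) : (p - 2) * y <> a * h%:Z.
    by move=> e; have /negP := ndvd _ ph2; apply; apply/dvdzP; exists a.
  have e' : ((p * (h - y)%N%:Z) %/ h%:Z)%Z = p - 1 - ((p * y%:Z) %/ h%:Z)%Z.
    have -> : p * (h - y)%N%:Z = (p - 1 - ((p * y%:Z) %/ h%:Z)%Z) * h%:Z
        + (h%:Z - ((p * y%:Z) %% h%:Z)%Z).
      by rewrite -subzn ?(ltnW y1)// mulrBr [in LHS]d; ring.
    move: (_ %% _)%Z m0 m1 m2 {d} => r m0 m1 m2.
    rewrite divzMDl; last by lia.
    by rewrite [X in _ + X]divz_small ?addr0//; clear -m0 m1 m2 h0; lia.
  rewrite e'.
  move: (_ %% _)%Z (_ %/ _)%Z m0 m1 m2 d {e'} => r q m0 m1 m2 d.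
  (* The four tests amount to [2 y < h + r], [2 y < r], [r < 2 y] and [h + r < 2 y]. The instances
     [q] and [q - 1] of [m3] exclude the ties, so exactly two of them hold. *)
  have n0 := m3 q; have n1 := m3 (q - 1); rewrite mulrBl d in n0 n1.
  rewrite -subzn ?(ltnW y1)//.
  have -> : (q + 1 + 0%:Z) * h%:Z - y%:Z * p = h%:Z - r by rewrite [y%:Z * p]mulrC d; ring.
  have -> : (q + 1 + 1%:Z) * h%:Z - y%:Z * p = h%:Z *+ 2 - r by rewrite [y%:Z * p]mulrC d; ring.
  have -> : (p - 1 - q + 1 + 0%:Z) * h%:Z - (h%:Z - y%:Z) * p = r.
    by rewrite [(h%:Z - _) * p]mulrBl [y%:Z * p]mulrC d; ring.
  have -> : (p - 1 - q + 1 + 1%:Z) * h%:Z - (h%:Z - y%:Z) * p = h%:Z + r.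
    by rewrite [(h%:Z - _) * p]mulrBl [y%:Z * p]mulrC d; ring.
  rewrite mulrBl mul1r in n1; clear -m0 m1 m2 n0 n1 y0 y1.
  move: (q * h%:Z) n0 n1 => qh n0 n1; lia.
suff : ((\sum_(1 <= y < h) (c y 0 + c y 1)).*2 = h.-1.*2)%N by move/double_inj.
rewrite -addnn [X in (_ + X)%N]big_nat_rev -big_split/= add1n.
rewrite (eq_big_nat _ _ (F2 := fun=> 2%N)) ?sum_nat_const_nat ?subn1 ?muln2//.
Qed.

(** * Integers [p] such that [p] and [p - 2] are coprime to [h] *)

(** Consecutive integers are coprime, and what is coprime to [m * j] is coprime to its square, hence
    to the divisor [h]. *)
Lemma coprime_near_multiple (m j h : nat) : (0 < m * j)%N -> (h %| (m * j) ^ 2)%N ->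
  coprime (m * j).+1 h /\ coprime (m * j).-1 h.
Proof.
move=> q0 hq; have cS n : coprime n (m * j) -> coprime n h.
  by move=> c; apply: coprime_dvdr hq _; rewrite coprimeXr.
by split; apply: cS; [exact: coprimeSn | exact: coprimePn].
Qed.

Lemma coprime_prime_mul (r n h m : nat) : prime r -> h = (r * m)%N ->
  coprime n m -> ~~ (r %| n)%N -> coprime n h.
Proof. by move=> pr -> nm rn; rewrite coprimeMr nm andbT coprime_sym prime_coprime. Qed.

(* With q = p - 1, both p and p - 2 are coprime to h when h divides q^2, which
   settles h divisible by a square (q = h / r if r^2 divides h).  If a prime r > 4
   divides h, take q = h / r or q = 2 h / r, whichever is not +-1 modulo r.
   If 3 does not divide h, q = 2 already works. *)
Lemma exists_coprime_pair (h : nat) : (3 < h)%N -> h != 6%N ->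
  exists p : nat, [/\ (2 < p)%N, (p < h)%N, coprime p h & coprime (p - 2) h].
Proof.
move=> h4 h6.
suff [q [q1 qh c1 c2]] : exists q : nat,
    [/\ (1 < q)%N, (q < h)%N, coprime q.+1 h & coprime q.-1 h].
  exists q.+1; rewrite subSS subn1; split=> //.
  (* [q + 1 = h] is impossible, as [q + 1] is coprime to [h > 1]. *)
  rewrite ltn_neqAle qh andbT; apply/eqP => e.
  by move: c1; rewrite e /coprime gcdnn; lia.
have square r : (1 < r)%N -> (r ^ 2 %| h)%N -> exists q : nat,
    [/\ (1 < q)%N, (q < h)%N, coprime q.+1 h & coprime q.-1 h].
  move=> r1 /dvdnP[a ha]; exists (a * r)%N.
  have a0 : (0 < a)%N by lia.
  have [||c1 c2] := @coprime_near_multiple a r h; first by nia.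
    by rewrite ha; apply/dvdnP; exists a; rewrite expnMn; lia.
  by split=> //; nia.
have large r : prime r -> (4 < r)%N -> (r %| h)%N -> exists q : nat,
    [/\ (1 < q)%N, (q < h)%N, coprime q.+1 h & coprime q.-1 h].
  move=> pr r4 /dvdnP[m hm].
  have m0 : (0 < m)%N by lia.
  (* Both neighbours of a multiple of [m] are coprime to [m]; as [h = r m], only divisibility by [r]
     remains to be checked. *)
  have near j : (0 < j)%N -> ~~ (r %| (m * j).+1)%N -> ~~ (r %| (m * j).-1)%N ->
      coprime (m * j).+1 h /\ coprime (m * j).-1 h.
    move=> j0 r1 r2; have hm' : h = (r * m)%N by rewrite mulnC.
    have c n : coprime n (m * j) -> coprime n m.
      by rewrite coprimeMr => /andP[].
    split; apply: (coprime_prime_mul pr hm') => //; apply: c.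
      exact: coprimeSn.
    by apply: coprimePn; nia.
  have apart a b : (r %| a)%N -> (r %| b)%N -> (b < a <= b + 3)%N -> False.
    move=> ra rb ab; have : (r <= a - b)%N by rewrite dvdn_leq ?dvdn_sub//; lia.
    by lia.
  (* If [r] divides [m + 1] or [m - 1], it divides [2 m + 2] or [2 m - 2], which are at distance 1
     or 3 from [2 m + 1] and [2 m - 1]; distinct multiples of [r > 4] are not that close. *)
  have [d|] := boolP ((r %| m.+1) || (r %| m.-1))%N.
    have [||c1 c2] := near 2%N isT; last by exists (m * 2)%N; split => //; nia.
    - apply/negP => d'; case/orP: d => /(dvdn_mull 2) d.
        by apply: apart d d' _; lia.
      by apply: apart d' d _; lia.
    - apply/negP => d'; case/orP: d => /(dvdn_mull 2) d.
        by apply: apart d d' _; lia.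
      by apply: apart d' d _; lia.
  rewrite negb_or => /andP[d1 d2].
  have [||c1 c2] := near 1%N isT; rewrite ?muln1//.
  rewrite muln1 in c1 c2.
  exists m; split=> //; last by nia.
  (* [m = 1] is excluded because [r] would divide [m - 1 = 0]. *)
  by case: (m) m0 d2 => [|[|k]] //=; rewrite dvdn0.
have [/dvdnP[m hm]|h3] := boolP (3 %| h)%N.
  have [/dvdnP[n mn]|m3] := boolP (3 %| m)%N.
    by apply: (square 3%N) => //; rewrite hm mn -mulnA dvdn_mull.
  have [|h4'] := boolP (4 %| h)%N; first exact: (square 2%N).
  (* Here [h = 3 m] and neither 4 nor 9 divides [h], so [n] is the odd part of [m]. It exceeds 1
     because [h] is neither 3 nor 6, and its prime factors are at least 5. *)
  pose n := if odd m then m else m./2.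
  have n1 : (1 < n)%N by rewrite /n; case: ifP; lia.
  have nm : (n %| m)%N.
    rewrite /n; case: ifP => // om; apply/dvdnP; exists 2%N; lia.
  have pn := pdiv_prime n1; have rm := dvdn_trans (pdiv_dvd n) nm.
  apply: (large (pdiv n)) => //; last by rewrite hm dvdn_mulr.
  have r2 : pdiv n != 2%N.
    apply/eqP => e; have := pdiv_dvd n; by rewrite e /n dvdn2; case: ifP; lia.
  have r3 : pdiv n != 3%N by apply: contraNneq m3 => <-.
  have := prime_gt1 pn; have r4 : pdiv n != 4%N by apply: contraTneq pn => ->.
  lia.
exists 2%N; split; rewrite ?coprime1n//; first by lia.
by rewrite prime_coprime.
Qed.

(** Modulo 2, 3 or 6 the only residue [r] with [r] and [r - 2] both coprime to the modulus is 1; the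
    residues below 6 are tried one by one. *)
Lemma coprime_modular_case (h : nat) (p : int) : h \in [:: 2; 3; 6]%N ->
  coprimez p h -> coprimez (p - 2) h -> exists m : int, p = 1 + m * h%:Z.
Proof.
move=> hh; have d := divz_eq p h%:Z.
have h0 : (0 < h)%N by move: hh; rewrite !inE => /or3P[] /eqP->.
have m0 : 0 <= (p %% h%:Z)%Z by rewrite modz_ge0//; lia.
have m1 : (p %% h%:Z)%Z < h%:Z by rewrite ltz_pmod//; lia.
have e (a : int) : coprimez (p + a) h -> gcdz ((p %% h%:Z)%Z + a) h = 1.
  by rewrite /coprimez gcdzC {1}d -addrA gcdzMDl gcdzC => /eqP.
rewrite -{1}[p]addr0 => /e + /e.
move: (_ %% _)%Z m0 m1 d {e} => r m0 m1 d e0 e2.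
have r1 : r = 1.
  have : r = 0 \/ r = 1 \/ r = 2 \/ r = 3 \/ r = 4 \/ r = 5.
    by move: hh; rewrite !inE; lia.
  move: hh e0 e2 m1 {d m0}; rewrite !inE => /or3P[] /eqP-> e0 e2 m1 [E|[E|[E|[E|[E|E]]]]];
    by move: e0 e2 m1; rewrite E.
by exists (p %/ h%:Z)%Z; rewrite {1}d r1 addrC.
Qed.

(** * The real triangle: half-planes, closedness and interior *)

Lemma triangle_rot (R : realType) (A B C : R * R) : triangle B C A = triangle A B C.
Proof.
apply/seteqP; split=> P [a [b [c [[a0 b0 c0] [s e1 e2]]]]].
  by exists c, a, b; split; split=> //; rewrite -?s ?e1 ?e2; ring.
by exists b, c, a; split; split=> //; rewrite -?s ?e1 ?e2; ring.
Qed.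

Lemma triangle_swap (R : realType) (A B C : R * R) : triangle B A C = triangle A B C.
Proof.
apply/seteqP; split=> P [a [b [c [[a0 b0 c0] [s e1 e2]]]]];
  by exists b, a, c; split; split=> //; rewrite -?s ?e1 ?e2; ring.
Qed.

(** The barycentric coordinates of [P] are its three orientations divided by [orient A B C]. *)
Lemma triangleE (R : realType) (A B C : R * R) : 0 < orient A B C ->
  triangle A B C =
  [set P | [/\ 0 <= orient A B P, 0 <= orient B C P & 0 <= orient C A P]].
Proof.
move=> D; apply/seteqP; split=> P /=.
  move=> [a [b [c [[a0 b0 c0] [s e1 e2]]]]].
  have {s} ea : a = 1 - b - c by rewrite -s; ring.
  split.
  - suff -> : orient A B P = c * orient A B C by rewrite mulr_ge0 // ltW.
    by rewrite /orient e1 e2 ea; ring.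
  - suff -> : orient B C P = a * orient A B C by rewrite mulr_ge0 // ltW.
    by rewrite /orient e1 e2 ea; ring.
  - suff -> : orient C A P = b * orient A B C by rewrite mulr_ge0 // ltW.
    by rewrite /orient e1 e2 ea; ring.
move=> [c0 a0 b0]; have Dn := lt0r_neq0 D.
exists (orient B C P / orient A B C), (orient C A P / orient A B C),
  (orient A B P / orient A B C).
have E (a b c x y z : R) : a / orient A B C * x + b / orient A B C * y +
    c / orient A B C * z = (a * x + b * y + c * z) / orient A B C.
  by rewrite !mulrDl ![_ / _ * _]mulrAC.
split; first by split; apply: divr_ge0 => //; exact: ltW.
split.
- rewrite -!mulrDl (_ : _ + _ = orient A B C) ?divff//.
  by rewrite /orient; ring.
- by rewrite E; apply: (canRL (mulfK Dn)); rewrite /orient; ring.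
- by rewrite E; apply: (canRL (mulfK Dn)); rewrite /orient; ring.
Qed.

Lemma orient_continuous (R : realType) (A B : R * R) : continuous (orient A B).
Proof.
move=> P; apply: cvgB; apply: cvgM; [exact: cvg_cst| |exact: cvg_cst|].
- by apply: cvgB; [exact: cvg_snd | exact: cvg_cst].
- by apply: cvgB; [exact: cvg_fst | exact: cvg_cst].
Qed.

Lemma closed_triangle (R : realType) (A B C : R * R) : 0 < orient A B C ->
  closed (triangle A B C).
Proof.
move=> D; rewrite triangleE//.
have c (A' B' : R * R) : closed [set P | 0 <= orient A' B' P].
  by apply: (@closed_comp _ _ (orient A' B') [set x | 0 <= x]) => [x _|];
    [exact: orient_continuous | exact: closed_ge].
rewrite (_ : [set P | _] = [set P | 0 <= orient A B P] `&`
  ([set P | 0 <= orient B C P] `&` [set P | 0 <= orient C A P])).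
  by apply: closedI; [exact: c | apply: closedI; exact: c].
by apply/seteqP; split=> P /= => [[] | [? []]].
Qed.

(* Moving from an edge point P away from the opposite vertex C leaves the triangle. *)
Lemma interior_triangle_side (R : realType) (A B C P : R * R) : 0 < orient A B C ->
  interior (triangle A B C) P -> 0 < orient A B P.
Proof.
move=> D iP; have := interior_subset iP.
rewrite triangleE// => -[c0 _ _]; rewrite lt_neqAle c0 andbT; apply/eqP => c0'.
pose Q (t : R) := (P.1 + t * (P.1 - C.1), P.2 + t * (P.2 - C.2)).
have QP : Q t @[t --> 0] --> P.
  have Q0 : Q 0 = P by rewrite /Q !mul0r !addr0 -surjective_pairing.
  have c (x d : R) : (x + t * d) @[t --> 0] --> x + 0 * d.
    by apply: cvgD; [exact: cvg_cst | apply: cvgM; [exact: cvg_id | exact: cvg_cst]].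
  by rewrite -Q0; exact: (cvg_pair (c P.1 (P.1 - C.1)) (c P.2 (P.2 - C.2))).
have : \forall t \near 0^'+, triangle A B C (Q t).
  have QP' : Q t @[t --> 0^'+] --> P by exact: cvg_within_filter QP.
  exact: QP' iP.
move=> near_in; near (0:R)^'+ => t.
have : triangle A B C (Q t) by near: t.
rewrite triangleE// => -[+ _ _].
(* [orient A B] is affine along the ray, so with [orient A B P = 0] it is negative at [Q t] for
   every [t > 0]. *)
have -> : orient A B (Q t) = (1 + t) * orient A B P - t * orient A B C.
  by rewrite /orient /Q /=; ring.
by rewrite -c0' mulr0 sub0r oppr_ge0 leNgt mulr_gt0.
Unshelve. all: by end_near.
Qed.

Lemma interior_triangleE (R : realType) (A B C : R * R) : 0 < orient A B C ->
  interior (triangle A B C) =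
  [set P | [/\ 0 < orient A B P, 0 < orient B C P & 0 < orient C A P]].
Proof.
move=> D; apply/seteqP; split.
  move=> P iP; split; first exact: interior_triangle_side iP.
    apply: (@interior_triangle_side _ _ _ A); first by rewrite orient_rot.
    by rewrite triangle_rot.
  apply: (@interior_triangle_side _ _ _ B); first by rewrite 2!orient_rot.
  by rewrite 2!triangle_rot.
have o (A' B' : R * R) : open [set P | 0 < orient A' B' P].
  by apply: (@open_comp _ _ (orient A' B') [set x | 0 < x]) => [x _|];
    [exact: orient_continuous | exact: open_gt].
rewrite (_ : [set P | _] = [set P | 0 < orient A B P] `&`
  ([set P | 0 < orient B C P] `&` [set P | 0 < orient C A P])); last first.
  by apply/seteqP; split=> Q /= => [[] | [? []]].
rewrite -open_subsetE.
  by move=> Q [/= q0 [q1 q2]]; rewrite triangleE//; split; apply: ltW.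
by apply: openI; [exact: o | apply: openI; exact: o].
Qed.

(** * Transfer between integer points and lattice points of the real plane *)

Definition lattice_point (R : realType) (z : int * int) : R * R :=
  (z.1%:~R, z.2%:~R).

Lemma lattice_point_inj (R : realType) : injective (@lattice_point R).
Proof. by move=> [x y] [x' y'] [/intr_inj -> /intr_inj ->]. Qed.

Lemma latticeP (R : realType) (P : R * R) :
  lattice P -> exists z, P = lattice_point R z.
Proof.
by case: P => x y [/= /intrP[a ->] /intrP[b ->]]; exists (a, b).
Qed.

Lemma lattice_lattice_point (R : realType) z : lattice (lattice_point R z).
Proof. by split; rewrite /= intr_int. Qed.

Lemma orient_lattice_point (R : realType) (A B C : int * int) :
  orient (lattice_point R A) (lattice_point R B) (lattice_point R C) =
  (orient A B C)%:~R.
Proof. by rewrite /orient /= !(intrM, intrB). Qed.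

(** The triangle is closed, so its frontier is given by the weak inequalities with not all of them
    strict, which is the criterion of [mem_boundary_seq]. *)
Lemma boundary_pointsE (R : realType) (A B C : int * int) : 0 < orient A B C ->
  boundary_points (lattice_point R A) (lattice_point R B) (lattice_point R C) =
  lattice_point R @` [set` boundary_seq A B C].
Proof.
move=> D; have D' : 0 < orient (lattice_point R A) (lattice_point R B) (lattice_point R C).
  by rewrite orient_lattice_point ltr0z.
rewrite /boundary_points /frontier interior_triangleE//.
rewrite -(closure_id _).1; last exact: closed_triangle.
rewrite triangleE//; apply/seteqP; split=> P /=.
  case=> /latticeP[z ->]; rewrite /= !orient_lattice_point !ler0z !ltr0z.
  move=> [[c a b] n]; exists z => //=; rewrite mem_boundary_seq//.
  by rewrite a b c/=; apply/and3P.
case=> z /=; rewrite mem_boundary_seq// => /and4P[c a b n] <-.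
split; first exact: lattice_lattice_point.
by rewrite /= !orient_lattice_point !ler0z !ltr0z; split=> //; apply/and3P.
Qed.

Lemma interior_pointsE (R : realType) (A B C : int * int) : 0 < orient A B C ->
  interior_points (lattice_point R A) (lattice_point R B) (lattice_point R C) =
  lattice_point R @`
    [set P | [&& 0 < orient A B P, 0 < orient B C P & 0 < orient C A P]].
Proof.
move=> D; have D' : 0 < orient (lattice_point R A) (lattice_point R B) (lattice_point R C).
  by rewrite orient_lattice_point ltr0z.
rewrite /interior_points interior_triangleE//; apply/seteqP; split=> P /=.
  case=> /latticeP[z ->]; rewrite /= !orient_lattice_point !ltr0z.
  by move=> /and3P i; exists z.
case=> z /= /and3P i <-; split; first exact: lattice_lattice_point.
by rewrite /= !orient_lattice_point !ltr0z.
Qed.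

Lemma card_uniq_seq (T : choiceType) (s : seq T) : uniq s -> [set` s] #= `I_(size s).
Proof.
case: s => [|x s] us; first by rewrite set_nil II0.
rewrite (_ : [set` x :: s] = nth x (x :: s) @` `I_(size (x :: s))).
  apply: inj_card_eq => i j; rewrite !inE /= => i1 j1 /eqP.
  by rewrite nth_uniq// => /eqP.
apply/seteqP; split=> y /=; first by move/(nthP x) => [i i1 <-]; exists i.
by case=> i i1 <-; exact: mem_nth.
Qed.

Lemma card_lattice_seq (R : realType) (s : seq (int * int)) n : uniq s ->
  lattice_point R @` [set` s] #= `I_n -> size s = n.
Proof.
move=> us e; apply/card_eq_II; apply: card_eq_trans e.
rewrite card_eq_sym; apply: card_eq_trans (card_uniq_seq us).
by apply: inj_card_eq => z z' _ _; exact: lattice_point_inj.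
Qed.

Lemma card_lattice_image (R : realType) (s : seq (int * int)) : uniq s ->
  lattice_point R @` [set` s] #= `I_(size s).
Proof.
move=> us; apply: card_eq_trans (card_uniq_seq us).
by apply: inj_card_eq => z z' _ _; exact: lattice_point_inj.
Qed.

(** * Collinearity of three points *)

(** On a common line, elimination shows that [orient A B C] annihilates both coefficients, one of
    which is nonzero. Conversely the line joins two distinct points among the three, or is vertical
    if all coincide. *)
Lemma collinear_orient (R : realType) (A B C : R * R) :
  collinear [set A; B; C] <-> orient A B C = 0.
Proof.
split.
  move=> [a [b [c [ab s]]]].
  have [eA eB eC] : [/\ line a b c A, line a b c B & line a b c C].
    by split; apply: s; [left; left | left; right | right].
  rewrite /line/= in eA eB eC.
  have ha : a * orient A B C = 0.
    rewrite (_ : _ * _ = (a * B.1 + b * B.2 - (a * A.1 + b * A.2)) * (C.2 - A.2)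
      - (a * C.1 + b * C.2 - (a * A.1 + b * A.2)) * (B.2 - A.2)).
      by rewrite eA eB eC subrr !mul0r subrr.
    by rewrite /orient; ring.
  have hb : b * orient A B C = 0.
    rewrite (_ : _ * _ = (a * C.1 + b * C.2 - (a * A.1 + b * A.2)) * (B.1 - A.1)
      - (a * B.1 + b * B.2 - (a * A.1 + b * A.2)) * (C.1 - A.1)).
      by rewrite eA eB eC subrr !mul0r subrr.
    by rewrite /orient; ring.
  apply/eqP; apply: contra_notT ab => D.
  by congr pair; apply: (mulIf D); rewrite mul0r.
move=> D.
have [AB|AB] := eqVneq A B; last first.
  exists (B.2 - A.2), (A.1 - B.1), ((B.2 - A.2) * A.1 + (A.1 - B.1) * A.2); split.
    move=> [e1 e2]; case/eqP: AB; case: A B e1 e2 {D} => [a1 a2] [b1 b2]/= e1 e2.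
    by congr pair; lra.
  by move=> _ [[->|->]|->]; rewrite /line /=; [by [] | ring | rewrite /orient in D; lra].
have [AC|AC] := eqVneq A C.
  exists 1, 0, A.1; split; first by case=> /eqP; rewrite oner_eq0.
  by move=> _ [[->|->]|->]; rewrite /line /= -?AB -?AC; ring.
exists (C.2 - A.2), (A.1 - C.1), ((C.2 - A.2) * A.1 + (A.1 - C.1) * A.2); split.
  move=> [e1 e2]; case/eqP: AC; case: A C e1 e2 {D AB} => [a1 a2] [b1 b2]/= e1 e2.
  by congr pair; lra.
by move=> _ [[->|->]|->]; rewrite /line /= -?AB; ring.
Qed.

(** * Unimodular affine coordinates *)

(** The affine map with origin [A] and basis [u], [v]; when the determinant is 1 it is an
    automorphism of the integer lattice. *)
Definition frame (A u v z : int * int) : int * int :=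
  (A.1 + z.1 * u.1 + z.2 * v.1, A.2 + z.1 * u.2 + z.2 * v.2).

Lemma orient_frame (A u v a b c : int * int) : u.1 * v.2 - u.2 * v.1 = 1 ->
  orient (frame A u v a) (frame A u v b) (frame A u v c) = orient a b c.
Proof.
move=> uv; rewrite -[RHS]mul1r -uv.
by rewrite /orient /frame /=; ring.
Qed.

Lemma frame_surj (A u v P : int * int) : u.1 * v.2 - u.2 * v.1 = 1 -> exists z, P = frame A u v z.
Proof.
move=> uv; exists ((P.1 - A.1) * v.2 - (P.2 - A.2) * v.1, u.1 * (P.2 - A.2) - u.2 * (P.1 - A.1)).
rewrite /frame [LHS]surjective_pairing /=; congr pair.
  by rewrite -[LHS](subrK A.1) -{1}[_ - A.1]mulr1 -uv; ring.
by rewrite -[LHS](subrK A.2) -{1}[_ - A.2]mulr1 -uv; ring.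
Qed.

Lemma frame_inj (A u v : int * int) : u.1 * v.2 - u.2 * v.1 = 1 -> injective (frame A u v).
Proof.
move=> uv z z' e.
rewrite [z]surjective_pairing [z']surjective_pairing; congr pair.
  have : ((frame A u v z).1 - A.1) * v.2 - ((frame A u v z).2 - A.2) * v.1 =
    ((frame A u v z').1 - A.1) * v.2 - ((frame A u v z').2 - A.2) * v.1 by rewrite e.
  rewrite (_ : _ - _ = z.1 * (u.1 * v.2 - u.2 * v.1)); last by rewrite /frame/=; ring.
  by rewrite uv mulr1 => ->; rewrite -[RHS]mulr1 -uv /frame/=; ring.
have : u.1 * ((frame A u v z).2 - A.2) - u.2 * ((frame A u v z).1 - A.1) =
  u.1 * ((frame A u v z').2 - A.2) - u.2 * ((frame A u v z').1 - A.1) by rewrite e.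
rewrite (_ : _ - _ = z.2 * (u.1 * v.2 - u.2 * v.1)); last by rewrite /frame/=; ring.
by rewrite uv mulr1 => ->; rewrite -[RHS]mulr1 -uv /frame/=; ring.
Qed.

(** The matrix and its inverse are both integral, so each pair of coordinate differences consists of
    integer combinations of the other and the two gcds divide each other. *)
Lemma edge_gcd_frame (A u v z z' : int * int) : u.1 * v.2 - u.2 * v.1 = 1 ->
  edge_gcd (frame A u v z) (frame A u v z') = edge_gcd z z'.
Proof.
move=> uv; rewrite /edge_gcd.
set x := z'.1 - z.1; set y := z'.2 - z.2.
have -> : (frame A u v z').1 - (frame A u v z).1 = x * u.1 + y * v.1.
  by rewrite /frame /= /x /y; ring.
have -> : (frame A u v z').2 - (frame A u v z).2 = x * u.2 + y * v.2.
  by rewrite /frame /= /x /y; ring.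
have dvdD (d : nat) (a b c e : int) : (d %| `|a|)%N -> (d %| `|b|)%N ->
    (d %| absz (c * a + e * b)%R)%N.
  by move=> da db; rewrite -(dvdzE d) rpredD// dvdz_mull// dvdzE.
apply/eqP; rewrite eqn_dvd !dvdn_gcd -!andbA; apply/and4P; split.
- set a := x * u.1 + _; set b := _ + _.
  rewrite [x](_ : _ = v.2 * a + - v.1 * b); first exact: dvdD (dvdn_gcdl _ _) (dvdn_gcdr _ _).
  by rewrite -[LHS]mulr1 -uv /a /b; ring.
- set a := x * u.1 + _; set b := _ + _.
  rewrite [y](_ : _ = - u.2 * a + u.1 * b); first exact: dvdD (dvdn_gcdl _ _) (dvdn_gcdr _ _).
  by rewrite -[LHS]mulr1 -uv /a /b; ring.
- by rewrite [x * _]mulrC [y * _]mulrC; exact: dvdD (dvdn_gcdl _ _) (dvdn_gcdr _ _).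
- by rewrite [x * _]mulrC [y * _]mulrC; exact: dvdD (dvdn_gcdl _ _) (dvdn_gcdr _ _).
Qed.

(** The primitive direction of [A B] serves as [u], and its Bezout coefficients complete it to a
    basis of determinant 1. Then [orient A B C = 2 h], whence [h > 0]. *)
Lemma frame_exists (A B C : int * int) : 0 < orient A B C -> edge_gcd A B = 2%N ->
  exists O u v : int * int, exists (p : int) (h : nat),
    [/\ u.1 * v.2 - u.2 * v.1 = 1, (0 < h)%N, A = frame O u v (0, 0),
        B = frame O u v (2, 0) & C = frame O u v (p, h%:Z)].
Proof.
move=> D g2; have g0 := edge_gcd_gt0 D.
have [w1 [w2 [s [t [e1 e2 e]]]]] := edge_gcdP g0.
have uv : (w1, w2).1 * (- t, s).2 - (w1, w2).2 * (- t, s).1 = 1 by rewrite /= -e; ring.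
have eA : A = frame A (w1, w2) (- t, s) (0, 0).
  by rewrite /frame/= !mul0r !addr0 -surjective_pairing.
have eB : B = frame A (w1, w2) (- t, s) (2, 0).
  rewrite g2 in e1 e2.
  rewrite /frame/= !mul0r !addr0 [LHS]surjective_pairing.
  by congr pair; [rewrite mulrC -e1 | rewrite mulrC -e2]; rewrite addrC subrK.
have [[p h] eC] := frame_surj A C uv.
have h0 : 0 < h by move: D; rewrite {1}eA {1}eB {1}eC orient_frame// /orient/=; lia.
exists A, (w1, w2), (- t, s), p, `|h|%N; split=> //; first by lia.
by rewrite gez0_abs// ltW.
Qed.

Lemma interior_points_frame (R : realType) (A u v : int * int) (p : int) (h : nat) :
  u.1 * v.2 - u.2 * v.1 = 1 -> (0 < h)%N ->
  interior_points (lattice_point R (frame A u v (0, 0)))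
    (lattice_point R (frame A u v (2, 0))) (lattice_point R (frame A u v (p, h%:Z))) =
  lattice_point R @` [set` map (frame A u v) (interior_seq p h)].
Proof.
move=> uv h0; rewrite interior_pointsE; last first.
  by rewrite orient_frame// /orient /=; lia.
have inside z : (z \in interior_seq p h) = [&& 0 < orient (0, 0) (2, 0) z,
    0 < orient (2, 0) (p, h%:Z) z & 0 < orient (p, h%:Z) (0, 0) z].
  rewrite mem_interior_seq//.
  have -> : orient (0, 0) (2, 0) z = z.2 *+ 2 by rewrite /orient/=; ring.
  have -> : orient (p, h%:Z) (0, 0) z = z.1 * h%:Z - z.2 * p by rewrite /orient/=; ring.
  have -> : orient (2, 0) (p, h%:Z) z = h%:Z *+ 2 - (z.1 * h%:Z - z.2 * p + z.2 *+ 2).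
    by rewrite /orient/=; ring.
  by rewrite pmulrn_lgt0// !subr_gt0; congr (_ && _); exact: andbC.
congr image; apply/seteqP; split=> P /=.
  have [z ->] := frame_surj A P uv.
  by rewrite !orient_frame// -inside => /map_f.
by case/mapP=> z + ->; rewrite !orient_frame// inside.
Qed.

(** * Collinear and non-collinear interiors, and the classification *)

Lemma collinear_interior (R : realType) (k : nat) (A B C : int * int) :
  0 < orient A B C -> edge_gcd A B = 2%N -> edge_gcd B C = 1%N -> edge_gcd C A = 1%N ->
  interior_points (lattice_point R A) (lattice_point R B) (lattice_point R C) #= `I_k ->
  k \in [:: 1; 2; 5]%N ->
  collinear (interior_points (lattice_point R A) (lattice_point R B) (lattice_point R C)).
Proof.
move=> D gAB; have [Z [u [v [p [h [uv h0 -> -> ->]]]]]] := frame_exists D gAB.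
rewrite !edge_gcd_frame// interior_points_frame//= /edge_gcd /= => gBC gCA ck hk.
have cp : coprimez p h by move: gCA; rewrite !sub0r !abszN coprimezE /coprime => ->.
have cp2 : coprimez (p - 2) h by move: gBC; rewrite addn0 coprimezE /coprime => ->.
have us : uniq (map (frame Z u v) (interior_seq p h)).
  by rewrite map_inj_uniq ?interior_seq_uniq//; exact: frame_inj.
have hh : h \in [:: 2; 3; 6]%N.
  have := card_lattice_seq us ck; rewrite size_map size_interior_seq// => e.
  by move: hk; rewrite -e !inE; lia.
have [m em] := coprime_modular_case hh cp cp2.
(* The shear: in the basis [u], [w = v + m u] the abscissa becomes [z.1 - m * z.2] and the apex
   becomes [(1, h)]. *)
have [w1 ew1] : exists w1, w1 = v.1 + m * u.1 by eexists.
have [w2 ew2] : exists w2, w2 = v.2 + m * u.2 by eexists.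
have uw : u.1 * w2 - u.2 * w1 = 1 by rewrite -uv ew1 ew2; ring.
(* The line through [Z + u] with direction [w]; the constant 1 is the determinant of [u] and [w]. *)
exists w2%:~R, (- w1%:~R), (1 + Z.1 * w2 - Z.2 * w1)%:~R; split.
  move=> [/eqP + /eqP]; rewrite oppr_eq0 !intr_eq0 => /eqP e2 /eqP e1.
  by move: uw; rewrite e1 e2 !mulr0 subrr.
move=> _ [_ /= /mapP[z zi ->] <-]; rewrite /line/=.
have z1 : z.1 - m * z.2 = 1.
  move: zi; rewrite mem_interior_seq// em => /and3P[y0 c1 c2].
  have e : z.1 * h%:Z - z.2 * (1 + m * h%:Z) = (z.1 - m * z.2) * h%:Z - z.2 by ring.
  rewrite e in c1 c2.
  have : z.1 - m * z.2 < 2 by rewrite -(@ltr_pM2r _ h%:Z) ?ltz_nat//; lia.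
  have : 0 < z.1 - m * z.2 by rewrite -(@ltr_pM2r _ h%:Z) ?ltz_nat//; lia.
  by lia.
rewrite mulNr -!intrM -intrB; congr (_%:~R).
rewrite -[in RHS]z1 -[in RHS](mulr1 (z.1 - _)) -uw /frame/=.
by rewrite ew1 ew2; ring.
Qed.

(** Row 1 is the open interval from [p / h] to [2 + (p - 2) / h], whose ends lie in []0, 1[] and
    []2, 3[]. A line through its two lattice points is this row, which cannot hold all [h - 1 >= 3]
    points. *)
Lemma not_collinear_interior (R : realType) (p h : nat) : (2 < p < h)%N ->
  coprime p h -> coprime (p - 2) h ->
  ~ collinear (lattice_point R @` [set` interior_seq p%:Z h]).
Proof.
move=> /andP[p2 ph] c c2 [a [b [c0 [ab s]]]].
have h0 : (0 < h)%N by lia.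
have i1 : (1, 1) \in interior_seq p%:Z h by rewrite mem_interior_seq//=; lia.
have i2 : (2, 1) \in interior_seq p%:Z h by rewrite mem_interior_seq//=; lia.
have onl z : z \in interior_seq p%:Z h -> a * z.1%:~R + b * z.2%:~R = c0.
  by move=> zi; apply: (s (lattice_point R z)); exists z.
have a0 : a = 0 by have := onl _ i1; have := onl _ i2; rewrite /=; lra.
have b0 : b != 0 by apply: contra_notN ab => /eqP ->; rewrite a0.
have y1 z : z \in interior_seq p%:Z h -> z.2 = 1.
  move=> /onl; rewrite -(onl _ i1) a0 !mul0r !add0r => /(mulfI b0).
  exact: intr_inj.
have sub : {subset interior_seq p%:Z h <= [:: (1, 1); (2, 1)]}.
  move=> [x y] zi; have /= ey := y1 _ zi; move: zi.
  rewrite ey mem_interior_seq//= !inE !xpair_eqE eqxx !andbT => /andP[x0 x1].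
  have : x < 3 by rewrite -(@ltr_pM2r _ h%:Z) ?ltz_nat//; lia.
  have : 0 < x by rewrite -(@ltr_pM2r _ h%:Z) ?ltz_nat//; lia.
  lia.
have := uniq_leq_size (interior_seq_uniq p h) sub.
rewrite size_interior_seq ?coprimezE//=; first by lia.
by rewrite subzn// ltnW.
Qed.

Lemma has_counts_model (R : realType) (p : int) (h : nat) : (0 < h)%N ->
  coprimez p h -> coprimez (p - 2) h ->
  exists A B C : R * R, has_counts 4 h.-1 A B C /\
    interior_points A B C = lattice_point R @` [set` interior_seq p h].
Proof.
move=> h0 cp cp2.
(* The model is the identity frame, so [interior_points_frame] applies to it. *)
have uv : (1 : int, 0 : int).1 * (0 : int, 1 : int).2 -
  (1 : int, 0 : int).2 * (0 : int, 1 : int).1 = 1 by [].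
have fz z : frame (0, 0) (1, 0) (0, 1) z = z.
  by rewrite /frame/= !mulr1 !mulr0 !addr0 !add0r -surjective_pairing.
have := @interior_points_frame R (0, 0) (1, 0) (0, 1) p h uv h0.
rewrite !fz (eq_map fz) map_id => ie.
have D : 0 < orient (0, 0) (2, 0) (p, h%:Z) by rewrite /orient/=; lia.
exists (lattice_point R (0, 0)), (lattice_point R (2, 0)), (lattice_point R (p, h%:Z)).
split=> //; split.
- split; try exact: lattice_lattice_point.
  by rewrite collinear_orient orient_lattice_point => /eqP; rewrite intr_eq0 gt_eqF.
- rewrite boundary_pointsE//.
  have -> : 4%N = size (boundary_seq (0, 0) (2, 0) (p, h%:Z)).
    rewrite size_boundary_seq /edge_gcd /= !addn0 !sub0r !abszN.
    by move: cp cp2; rewrite !coprimezE /coprime /= => /eqP-> /eqP->.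
  exact: card_lattice_image (boundary_seq_uniq D).
- rewrite ie -(size_interior_seq h0 cp cp2).
  exact: card_lattice_image (interior_seq_uniq p h).
Qed.

Lemma collinear_counts (R : realType) (k : nat) (A B C : R * R) :
  k \in [:: 1; 2; 5]%N -> has_counts 4 k A B C -> collinear (interior_points A B C).
Proof.
move=> hk [[/latticeP[a ->] /latticeP[b ->] /latticeP[c ->]] {A B C}].
rewrite collinear_orient orient_lattice_point => /eqP; rewrite intr_eq0.
(* Swapping two vertices negates the orientation and preserves the triangle. *)
wlog D : a b / 0 < orient a b c => [hw|].
  have [D _|D|//] := ltgtP 0 (orient a b c).
    by apply: hw; rewrite ?gt_eqF.
  rewrite /boundary_points /interior_points -triangle_swap => _.
  by apply: hw; rewrite ?gt_eqF// orient_swap oppr_gt0.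
move=> _; rewrite boundary_pointsE// => /(card_lattice_seq (boundary_seq_uniq D)).
rewrite size_boundary_seq.
have D1 : 0 < orient b c a by rewrite orient_rot.
have D2 : 0 < orient c a b by rewrite 2!orient_rot.
have g0 := edge_gcd_gt0 D; have g1 := edge_gcd_gt0 D1; have g2 := edge_gcd_gt0 D2.
move=> g4.
(* Three positive lattice lengths with sum 4 are 2, 1, 1 in some order; a rotation puts the long
   edge first. *)
have [[ga gb gc]|[[ga gb gc]|[ga gb gc]]] :
  [/\ edge_gcd a b = 2, edge_gcd b c = 1 & edge_gcd c a = 1]%N \/
  [/\ edge_gcd b c = 2, edge_gcd c a = 1 & edge_gcd a b = 1]%N \/
  [/\ edge_gcd c a = 2, edge_gcd a b = 1 & edge_gcd b c = 1]%N.
- move: (edge_gcd a b) (edge_gcd b c) (edge_gcd c a) g0 g1 g2 g4 => x y z *.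
  have : x = 2%N \/ y = 2%N \/ z = 2%N by lia.
  by case=> [|[]] e; [left | right; left | right; right]; split; lia.
- by move=> i; exact: (collinear_interior D ga gb gc i hk).
- rewrite /interior_points -triangle_rot => i.
  exact: (collinear_interior D1 ga gb gc i hk).
- rewrite /interior_points -2!triangle_rot => i.
  exact: (collinear_interior D2 ga gb gc i hk).
Qed.

Theorem theorem1 (R : realType) (k : nat) (hk : (0 < k)%N) :
  B_collinear R 4 k <-> (k = 1 \/ k = 2 \/ k = 5)%N.
Proof.
split.
  move=> [_ all_collinear].
  have [|k_large] := boolP (k \in [:: 1; 2; 5]%N).
    by rewrite !inE => /or3P[] /eqP; auto.
  (* The height is [h = k + 1]; for positive [k] outside 1, 2, 5 it is at least 4 and different from
     6. *)
  have [||p [p2 ph c c2]] := @exists_coprime_pair k.+1.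
  - by move: k_large; rewrite !inE; lia.
  - by move: k_large; rewrite !inE; lia.
  have [|A [B [C [/all_collinear]]]] := @has_counts_model R p%:Z k.+1 isT c.
    by rewrite -[2]/(2%N%:Z) subzn// ltnW.
  move=> + e; rewrite e => /not_collinear_interior; case=> //.
  by rewrite p2 ph.
move=> kE; split.
  (* With [p = 1], both [p] and [p - 2 = -1] are units, hence coprime to any height. *)
  have [||A [B [C [abc _]]]] := @has_counts_model R 1 k.+1 isT.
  - by rewrite coprimezE /= coprime1n.
  - by rewrite coprimezE /= coprime1n.
  by exists A, B, C.
move=> A B C; apply: collinear_counts.
by rewrite !inE; case: kE => [->|[]->].
Qed.
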